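(* Let $m\in\{0,1,2\}$ and let $\Sigma=(\sigma_{ij})$ be a positive definite real $p\times p$ matrix with $p\ge 2(m+1)$. Then $\Sigma\in F_{p,m}$ if and only if for every index set $A\subseteq\{1,\dots,p\}$ with $|A|=2(m+1)$, the principal submatrix $\Sigma_{A,A}=(\sigma_{ij})_{i,j\in A}$ belongs to $F_{2(m+1),m}$.
   Context: For integers $p\ge 1$, $m\ge 1$, $F_{p,m}=\{\Delta+\Gamma\Gamma^t : \Delta \text{ a positive definite diagonal } p\times p \text{ matrix},\ \Gamma\in\mathbb{R}^{p\times m}\}$ (the covariance matrices of the factor analysis model with $m$ factors). For $m=0$, $F_{p,0}$ is the set of positive definite diagonal $p\times p$ matrices. *)

(* Defs.v *)
From HB Require Import structures.
From mathcomp Require Import all_boot all_order all_algebra.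
Set Implicit Arguments. Unset Strict Implicit. Unset Printing Implicit Defensive.
Import Order.TTheory GRing.Theory Num.Theory.
Local Open Scope ring_scope.

Definition posdef (R : rcfType) (p : nat) (S : 'M[R]_p) : Prop :=
  S^T = S /\ forall x : 'rV[R]_p, x != 0 -> 0 < (x *m S *m x^T) 0 0.

(* F_{p,m} = { Delta + Gamma Gamma^T : Delta pos. def. diagonal, Gamma p x m }.
   For m = 0, Gamma Gamma^T = 0, so this is the set of pos. def. diagonal matrices. *)
Definition factor_model (R : rcfType) (p m : nat) (S : 'M[R]_p) : Prop :=
  exists (d : 'rV[R]_p) (G : 'M[R]_(p, m)),
    (forall i, 0 < d 0 i) /\ S = diag_mx d + G *m G^T.

(* Principal submatrix Sigma_{A,A}, indices of A taken in increasing order. *)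
Definition principal_submx (R : rcfType) (p : nat) (S : 'M[R]_p)
  (A : {set 'I_p}) : 'M[R]_#|A| :=
  \matrix_(i < #|A|, j < #|A|) S (enum_val i) (enum_val j).

(* Main.v *)
Require Import Defs.
From HB Require Import structures.
From mathcomp Require Import all_boot all_order all_algebra.
From mathcomp Require Import ring zify.
Import Order.TTheory GRing.Theory Num.Theory.
Local Open Scope ring_scope.

Set Implicit Arguments.
Unset Strict Implicit.
Unset Printing Implicit Defensive.

(* Write [v_a] for the rows of [Gamma]: one needs vectors of R^m with
   [v_a . v_b = sigma_ab] off the diagonal and [|v_a|^2 < sigma_aa].

   Suppose some m x m minor of [S] with disjoint row set I and column set J is
   nonzero. Every [v_a] with a outside J is then a combination of the [v_i],
   i in I, with coefficients read off from [S], so only the squared lengths of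
   the [v_i] are unknown. Each outside index a gives, for each i in I, a linear
   equation involving the squared length of [v_i] alone, so one index per i
   decides everything; I, J and these m indices number 3m <= 2m + 2, and all
   other conditions involve I, J and two further indices.

   For m = 2 with all those minors (the tetrads) zero, consider the graph of
   nonzero off-diagonal entries. If it has two disjoint edges, the off-diagonal
   part of [S] is that of [g g^T], and the planar vectors of four vertices of a
   clique satisfy [|v_a|^2 >= g_a^2], so [g] is a one-factor solution. Otherwise
   at most three indices are not isolated, as a star with three leaves would
   give three orthogonal nonzero vectors in the plane. *)

(** * Gram matrices and fits on a set of indices *)

Definition gram (R : rcfType) (p m : nat) (G : 'M[R]_(p, m)) : 'M[R]_p :=
  G *m G^T.

(** The diagonal summand is eliminated: its positivity becomes the strict inequality. [G] keeps all
    [p] rows, those outside [A] being free, so restricting [A] needs no reindexing. *)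
Definition fits (R : rcfType) (p m : nat) (S : 'M[R]_p) (A : {set 'I_p})
    (G : 'M[R]_(p, m)) : Prop :=
  (forall a b, a \in A -> b \in A -> a != b -> gram G a b = S a b) /\
  (forall a, a \in A -> gram G a a < S a a).

Lemma exists_superset_card (T : finType) (B : {set T}) (n : nat) :
  (#|B| <= n <= #|T|)%N -> exists2 A : {set T}, B \subset A & #|A| = n.
Proof.
move=> /andP[Bn nT]; pose s := take (n - #|B|) (enum (~: B)).
exists (B :|: [set x in s]); first exact: subsetUl.
have us : uniq s by rewrite take_uniq // enum_uniq.
rewrite cardsU disjoint_setI0 ?cards0 ?subn0; last first.
  rewrite -setI_eq0; apply/eqP/setP => x; rewrite !inE.
  by apply/negP => /andP[xB /mem_take]; rewrite mem_enum inE xB.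
rewrite cardsE (card_uniqP us) size_takel ?subnKC //.
by rewrite -cardE leq_subLR cardsC.
Qed.

Section Gram.
Variables (R : rcfType) (p m : nat).
Implicit Types (G : 'M[R]_(p, m)).

Lemma gramE G a b : gram G a b = \sum_k G a k * G b k.
Proof. by rewrite mxE; apply: eq_bigr => k _; rewrite mxE. Qed.

Lemma gramC G a b : gram G a b = gram G b a.
Proof. by rewrite !gramE; apply: eq_bigr => k _; rewrite mulrC. Qed.

Lemma gram_ge0 G a : 0 <= gram G a a.
Proof. by rewrite gramE sumr_ge0 // => k _; rewrite -expr2 sqr_ge0. Qed.

End Gram.

Lemma gram_rowsub (R : rcfType) (p m n : nat) (f : 'I_n -> 'I_p)
    (G : 'M[R]_(p, m)) i j :
  gram (rowsub f G) i j = gram G (f i) (f j).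
Proof. by rewrite !gramE; apply: eq_bigr => k _; rewrite !mxE. Qed.

Section Fits.
Variables (R : rcfType) (p m : nat).
Implicit Types (S : 'M[R]_p) (A B : {set 'I_p}) (G : 'M[R]_(p, m)).

Lemma fits_sub S A B G : A \subset B -> fits S B G -> fits S A G.
Proof.
move=> /subsetP AB [hd hD]; split=> [a b /AB aB /AB bB|a /AB aB]; first exact: hd.
exact: hD.
Qed.

Lemma fits_diag_gt0 S A G a : fits S A G -> a \in A -> 0 < S a a.
Proof. by move=> [_ hD] /hD; exact/le_lt_trans/gram_ge0. Qed.

(** An index outside [B] is isolated in the graph of nonzero off-diagonal entries, so the zero
    vector serves it. *)
Lemma fits_extend0 S B G : S^T = S -> (forall a, 0 < S a a) ->
  (forall a b, a \notin B -> a != b -> S a b = 0) -> fits S B G ->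
  fits S setT (\matrix_(a, k) if a \in B then G a k else 0).
Proof.
move=> symS posS S0 [hd hD].
have gE a b : gram (\matrix_(a, k) if a \in B then G a k else 0) a b =
    if (a \in B) && (b \in B) then gram G a b else 0.
  rewrite !gramE; case: ifP => [/andP[aB bB]|nab].
    by apply: eq_bigr => k _; rewrite !mxE aB bB.
  apply: big1 => k _; rewrite !mxE.
  by move: nab; do 2!case: ifP => _; rewrite ?mul0r ?mulr0.
split=> [a b _ _ ab|a _]; rewrite gE; last first.
  by rewrite andbb; case: ifP => [/hD|_].
case: (boolP (a \in B)) => [aB|/S0->//].
case: (boolP (b \in B)) => [bB|/S0 bS] /=; first exact: hd.
by rewrite -symS mxE bS // eq_sym.
Qed.

Lemma factor_modelE S : factor_model m S <-> exists G, fits S setT G.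
Proof.
have dE (d : 'rV[R]_p) G a b :
    (diag_mx d + G *m G^T) a b = d 0 a *+ (a == b) + gram G a b.
  by rewrite -/(gram G) !mxE.
split=> [[d [G [d0 ->]]]|[G [hd hD]]].
  exists G; split=> [a b _ _ /negbTE ab|a _]; rewrite dE.
    by rewrite ab mulr0n add0r.
  by rewrite eqxx mulr1n ltr_pwDl.
exists (\row_a (S a a - gram G a a)), G; split=> [a|].
  by rewrite mxE subr_gt0 hD ?inE.
apply/matrixP => a b; rewrite dE mxE.
have [<-|ab] := eqVneq a b; first by rewrite mulr1n subrK.
by rewrite mulr0n add0r (hd a b) ?inE.
Qed.

End Fits.

Lemma factor_model_principal (R : rcfType) (p m : nat) (S : 'M[R]_p) A :
  factor_model m (principal_submx S A) <->
  exists G : 'M[R]_(p, m), fits S A G.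
Proof.
have pE i j : principal_submx S A i j = S (enum_val i) (enum_val j) by rewrite mxE.
split=> [/factor_modelE[G [hd hD]]|[G [hd hD]]].
  (* The sum has at most one term: row [i] of [G] goes to [enum_val i], and rows outside [A] are
     zero. *)
  pose H := \matrix_(a, k) \sum_(i | enum_val i == a) G i k : 'M[R]_(p, m).
  have gH i j : gram H (enum_val i) (enum_val j) = gram G i j.
    rewrite !gramE; apply: eq_bigr => k _; rewrite !mxE.
    by congr (_ * _); apply: big_pred1 => x /=; rewrite (inj_eq enum_val_inj).
  have AE a : a \in A -> exists i : 'I_#|A|, a = enum_val i.
    by move=> aA; exists (enum_rank_in aA a); rewrite enum_rankK_in.
  exists H; split=> [a b /AE[i ->] /AE[j ->]|a /AE[i ->]]; rewrite gH.
    by rewrite (inj_eq enum_val_inj) => ij; rewrite hd ?inE ?pE.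
  by rewrite -pE hD ?inE.
apply/factor_modelE; exists (rowsub enum_val G).
split=> [i j _ _ ij|i _]; rewrite gram_rowsub pE; last exact/hD/enum_valP.
by rewrite hd ?enum_valP // (inj_eq enum_val_inj).
Qed.

(** * A nonzero minor with disjoint rows and columns *)

Section UnitMinor.
Variables (R : rcfType) (p m : nat) (S : 'M[R]_p) (f g : 'I_m -> 'I_p).
Hypotheses (injf : injective f) (fg : forall k l, f k != g l).
Implicit Types (A : {set 'I_p}).
Hypothesis unitB : mxsub f g S \in unitmx.

Let I := [set f k | k in 'I_m].
Let J := [set g k | k in 'I_m].
(** Coordinates of v_a in the basis of the v_i, i in I, found by solving against the columns of [S]
    at J. *)
Let c (a : 'I_p) : 'rV[R]_m := (\row_l S a (g l)) *m invmx (mxsub f g S).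

Let inJ l : g l \in J. Proof. exact: imset_f. Qed.
Let inI l : f l \in I. Proof. exact: imset_f. Qed.

Lemma fits_minorE A (G : 'M[R]_(p, m)) : I :|: J \subset A -> fits S A G ->
  rowsub f G *m (rowsub g G)^T = mxsub f g S.
Proof.
move=> /subsetP sA [hd _]; apply/matrixP => k l.
have -> : (rowsub f G *m (rowsub g G)^T) k l = gram G (f k) (g l).
  by rewrite gramE mxE; apply: eq_bigr => j _; rewrite !mxE.
by rewrite hd ?mxE // sA // inE ?inI ?inJ ?orbT.
Qed.

(** The invertible minor factors through the rows at J, so these form a basis, and a vector is
    determined by its products with a basis. For a outside J these products are entries of [S]. *)
Lemma fits_row A (G : 'M[R]_(p, m)) a : I :|: J \subset A -> fits S A G ->
  a \in A -> a \notin J -> row a G = c a *m rowsub f G.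
Proof.
move=> sA fA aA aJ; have fgE := fits_minorE sA fA.
have uW : (rowsub g G)^T \in unitmx.
  by move: unitB; rewrite -fgE unitmx_mul => /andP[].
apply: (can_inj (mulmxK uW)); rewrite -mulmxA fgE /c mulmxKV //.
apply/rowP => l; rewrite mxE.
have gJ : g l \in A by rewrite (subsetP sA) // inE inJ orbT.
rewrite [RHS]mxE -(fA.1 a (g l)) //; last by apply: contraNneq aJ => ->.
by rewrite gramE; apply: eq_bigr => k _; rewrite !mxE.
Qed.

Lemma gram_row_f (G : 'M[R]_(p, m)) a : row a G = c a *m rowsub f G ->
  forall b, gram G a b = \sum_k c a 0 k * gram G (f k) b.
Proof.
move=> aE b; under eq_bigr do rewrite gramE mulr_sumr.
rewrite exchange_big /= gramE; apply: eq_bigr => j _.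
have -> : G a j = row a G 0 j by rewrite mxE.
by rewrite aE mxE mulr_suml; apply: eq_bigr => k _; rewrite !mxE mulrA.
Qed.

(* The rows at [I] are only known up to their squared lengths, and any index
   with a nonzero [l]-th coordinate fixes the squared length at [f l]. *)
Lemma fits_diag_f A (G : 'M[R]_(p, m)) a l : I :|: J \subset A -> fits S A G ->
  a \in A -> a \notin I -> a \notin J -> c a 0 l != 0 ->
  gram G (f l) (f l) =
    (S a (f l) - \sum_(k | k != l) c a 0 k * S (f k) (f l)) / c a 0 l.
Proof.
move=> sA fA aA aI aJ cl; have IA k : f k \in A.
  by rewrite (subsetP sA) // inE inI.
have afl : a != f l by apply: contraNneq aI => ->.
rewrite -(fA.1 a (f l)) // (gram_row_f (fits_row sA fA aA aJ)) (bigD1 l) //=.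
rewrite [X in _ + X - _](eq_bigr (fun k => c a 0 k * S (f k) (f l))).
  by rewrite addrK mulrAC divff ?mul1r.
by move=> k kl; rewrite fA.1 // (inj_eq injf).
Qed.

Hypothesis m2 : (m <= 2)%N.
Hypothesis symS : S^T = S.
Hypothesis fitS : forall A : {set 'I_p}, (#|A| <= 2 * m.+1)%N ->
  exists G : 'M[R]_(p, m), fits S A G.

Let cardIJ : (#|I :|: J| <= 2 * m)%N.
Proof.
have cI : (#|I| <= m)%N by rewrite -[leqRHS]card_ord leq_imset_card.
have cJ : (#|J| <= m)%N by rewrite -[leqRHS]card_ord leq_imset_card.
by rewrite (leq_trans (leq_card_setU I J)) // mul2n -addnn leq_add.
Qed.

Let fitIJ2 a b : exists G : 'M[R]_(p, m), fits S (I :|: J :|: [set a; b]) G.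
Proof.
apply: fitS; rewrite (leq_trans (leq_card_setU _ _)) // cards2 mulnS addnC.
by rewrite leq_add // ltnS leq_b1.
Qed.

Lemma fits_of_unit_minor : exists G : 'M[R]_(p, m), fits S setT G.
Proof.
pose P l := [pred h | [&& h \notin I, h \notin J & c h 0 l != 0]].
(* The default [f l] adds nothing to the set below. It occurs only if no index outside I and J has a
   nonzero [l]-th coordinate; then only the diagonal inequality at [f l] involves that squared
   length. *)
pose h l := odflt (f l) [pick x | P l x].
have [|G fG] := fitS (A := I :|: J :|: [set h l | l in 'I_m]).
  have ch : (#|[set h l | l in 'I_m]| <= m)%N.
    by rewrite -[leqRHS]card_ord leq_imset_card.
  (* The bound 2m + m <= 2(m + 1) is where m <= 2 enters. *)
  rewrite (leq_trans (leq_card_setU _ _)) // (leq_trans (leq_add cardIJ ch)) //.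
  by lia.
set A := _ :|: _ in fG.
have sA : I :|: J \subset A by exact: subsetUl.
(* Both squared lengths are compared with that of a third fit, on I, J, [a] and [h l]. *)
have diagE A' (G' : 'M[R]_(p, m)) a l : I :|: J \subset A' -> fits S A' G' ->
    a \in A' -> a \notin I -> a \notin J -> c a 0 l != 0 ->
    gram G' (f l) (f l) = gram G (f l) (f l).
  move=> sA' fG' aA' aI aJ cl.
  have [hA hP] : h l \in A /\ P l (h l).
    split; first by rewrite inE imset_f ?orbT.
    rewrite /h; by case: pickP => // /(_ a); rewrite /P /= aI aJ cl.
  have /and3P[hI hJ hc] := hP.
  have [G2 fG2] := fitIJ2 a (h l).
  have s2 : I :|: J \subset I :|: J :|: [set a; h l] by exact: subsetUl.
  rewrite (fits_diag_f sA' fG' aA') // -(fits_diag_f s2 fG2) //; last first.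
    by rewrite !inE eqxx orbT.
  rewrite (fits_diag_f sA fG hA) // -(fits_diag_f s2 fG2) //.
  by rewrite !inE eqxx !orbT.
pose H := \matrix_a if a \in J then row a G else c a *m rowsub f G.
have rowJ a : a \in J -> row a H = row a G by move=> aJ; rewrite rowK aJ.
have rowA a : a \in A -> row a H = row a G.
  move=> aA; rewrite rowK; case: ifP => // /negbT aJ.
  by rewrite (fits_row sA fG aA).
have gramR (G1 G2 : 'M[R]_(p, m)) a b : row a G1 = row a G2 -> row b G1 = row b G2 ->
    gram G1 a b = gram G2 a b.
  move=> /rowP ra /rowP rb; rewrite !gramE; apply: eq_bigr => k _.
  by have := ra k; have := rb k; rewrite !mxE => -> ->.
have subA a : a \in I :|: J -> a \in A by exact/subsetP.
have IA k : f k \in A by rewrite subA // inE inI.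
have rowf : rowsub f H = rowsub f G.
  by apply/row_matrixP => k; rewrite !row_rowsub rowA.
have rowH a : a \notin J -> row a H = c a *m rowsub f H.
  by move=> aJ; rewrite rowK (negbTE aJ) rowf.
have gramIA k b : b \in A -> gram H (f k) b = gram G (f k) b.
  by move=> bA; apply: gramR; rewrite rowA.
have HJ a b : a \notin J -> b \in J -> gram H a b = S a b.
  move=> aJ /imsetP[l _ ->]; rewrite (gram_row_f (rowH a aJ)).
  have gA : g l \in A by rewrite subA // inE inJ orbT.
  have [G2 fG2] := fitIJ2 a a; set A2 := _ :|: _ in fG2.
  have s2 : I :|: J \subset A2 by exact: subsetUl.
  have aA2 : a \in A2 by rewrite inE set21 orbT.
  rewrite -(fG2.1 a) //; last by apply: contraNneq aJ => ->.
    rewrite (gram_row_f (fits_row s2 fG2 aA2 aJ)); apply: eq_bigr => k _.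
    rewrite gramIA // fG.1 // fG2.1 //; apply: (subsetP s2);
      by rewrite inE ?inI ?inJ ?orbT.
  by apply: (subsetP s2); rewrite inE inJ orbT.
(* The case [a = b] is included, so this yields the diagonal inequalities too. *)
have HnJ a b : a \notin J -> b \notin J ->
    exists2 G2 : 'M[R]_(p, m), fits S [set a; b] G2 & gram H a b = gram G2 a b.
  move=> aJ bJ; have [/andP[aI bI]|nI] := boolP ((a \in I) && (b \in I)).
    have aA : a \in A by rewrite subA // inE aI.
    have bA : b \in A by rewrite subA // inE bI.
    exists G; last by apply: gramR; rewrite rowA.
    by apply: fits_sub fG; apply/subsetP => x /set2P[]->.
  have [G2 fG2] := fitIJ2 a b; set A2 := _ :|: _ in fG2.
  have s2 : I :|: J \subset A2 by exact: subsetUl.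
  have IA2 k : f k \in A2 by rewrite (subsetP s2) // inE inI.
  have aA2 : a \in A2 by rewrite inE set21 orbT.
  have bA2 : b \in A2 by rewrite inE set22 orbT.
  exists G2; first by apply: fits_sub fG2; exact: subsetUr.
  have r2 x := fits_row s2 fG2 (a := x).
  rewrite (gram_row_f (rowH a aJ)) (gram_row_f (r2 a aA2 aJ)).
  apply: eq_bigr => k _; have [->|ck] := eqVneq (c a 0 k) 0; first by rewrite !mul0r.
  congr (_ * _); rewrite gramC (gram_row_f (rowH b bJ)).
  rewrite gramC (gram_row_f (r2 b bA2 bJ)).
  apply: eq_bigr => l _; have [->|cl] := eqVneq (c b 0 l) 0; first by rewrite !mul0r.
  congr (_ * _); rewrite gramIA //.
  (* Only the terms with [l = k] are not entries of [S]. There one of [a], [b] lies outside I with a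
     nonzero coordinate, so the squared length is the one fixed by [G]. *)
  have [lk|lk] := eqVneq l k; last by rewrite fG.1 ?fG2.1 // (inj_eq injf).
  rewrite {}lk in cl *.
  move: nI; rewrite negb_and => /orP[aI|bI].
    by rewrite (diagE A2 G2 a).
  by rewrite (diagE A2 G2 b).
exists H; split=> [a b _ _ ab|a _].
  have [aJ|aJ] := boolP (a \in J); have [bJ|bJ] := boolP (b \in J).
  - by rewrite (gramR H G) ?rowJ // fG.1 // subA // inE ?aJ ?bJ ?orbT.
  - by rewrite gramC HJ // -{1}symS mxE.
  - exact: HJ.
  - by have [G2 fG2 ->] := HnJ a b aJ bJ; rewrite fG2.1 // !inE eqxx ?orbT.
have [aJ|aJ] := boolP (a \in J).
  by rewrite (gramR H G) ?rowJ // fG.2 // subA // inE aJ orbT.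
by have [G2 fG2 ->] := HnJ a a aJ aJ; rewrite fG2.2 // !inE eqxx.
Qed.

End UnitMinor.

(** * Gram matrices of vectors in the plane *)

Ltac solve_uniq :=
  rewrite /= ?inE ?negb_or;
  repeat (apply/andP; split); try done; by rewrite eq_sym.

Lemma gram2E (R : rcfType) (p : nat) (G : 'M[R]_(p, 2)) a b :
  gram G a b = G a 0 * G b 0 + G a 1 * G b 1.
Proof.
rewrite gramE big_ord_recl big_ord1.
by have -> : lift ord0 ord0 = 1 :> 'I_2 by apply/val_inj.
Qed.

Lemma gram_diag_eq0 (R : rcfType) (p m : nat) (G : 'M[R]_(p, m)) a :
  gram G a a = 0 -> forall b, gram G b a = 0.
Proof.
rewrite gramE => /eqP; rewrite psumr_eq0 => [/allP Ga b|k _]; last first.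
  by rewrite -expr2 sqr_ge0.
rewrite gramE big1 // => k _; have := Ga k (mem_index_enum _).
by rewrite /= mulf_eq0 orbb => /eqP->; rewrite mulr0.
Qed.

(** Three vectors in the plane are dependent, so their Gram determinant vanishes. *)
Lemma gram2_det3 (R : rcfType) (p : nat) (G : 'M[R]_(p, 2)) a b c :
  gram G a a * gram G b b * gram G c c +
  2 * (gram G a b * gram G a c * gram G b c) -
  gram G a a * gram G b c ^+ 2 - gram G b b * gram G a c ^+ 2 -
  gram G c c * gram G a b ^+ 2 = 0.
Proof. by rewrite !gram2E; ring. Qed.

(* In the plane, [det(i,j) det(i,k) = |i|^2 (j.k) - (i.j) (i.k)], and the
   product over the three pairs drawn from [j], [k], [l] is a square. *)
Lemma gram2_cube_ge0 (R : rcfType) (p : nat) (G : 'M[R]_(p, 2)) i j k l y :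
  gram G i j * gram G i k = y * gram G j k ->
  gram G i j * gram G i l = y * gram G j l ->
  gram G i k * gram G i l = y * gram G k l ->
  0 <= gram G j k * gram G j l * gram G k l * (gram G i i - y) ^+ 3.
Proof.
pose D a := G i 0 * G a 1 - G i 1 * G a 0.
have DE a b : D a * D b = gram G i i * gram G a b - gram G i a * gram G i b.
  by rewrite /D !gram2E; ring.
(* Each hypothesis turns a product of two determinants into [gram G i i - y] times a Gram entry. *)
move=> ejk ejl ekl.
suff -> : gram G j k * gram G j l * gram G k l * (gram G i i - y) ^+ 3 =
  (D j * D k * D l) ^+ 2 by exact: sqr_ge0.
transitivity ((D j * D k) * (D j * D l) * (D k * D l)); last by ring.
by rewrite !DE ejk ejl ekl; ring.
Qed.

(** * Two factors with all tetrads zero *)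

Section Tetrads.
Variables (R : rcfType) (p : nat) (S : 'M[R]_p).
Hypothesis symS : forall a b, S a b = S b a.
Hypothesis posS : forall a, 0 < S a a.
Hypothesis fitS : forall A : {set 'I_p}, (#|A| <= 6)%N ->
  exists G : 'M[R]_(p, 2), fits S A G.
Hypothesis tetrad : forall i j k l, uniq [:: i; j; k; l] ->
  S i k * S j l = S i l * S j k.

Lemma fits_quadruple i j k l : uniq [:: i; j; k; l] ->
  exists G : 'M[R]_(p, 2),
    fits S [set x in [:: i; j; k; l]] G /\
    forall a b, a \in [:: i; j; k; l] -> b \in [:: i; j; k; l] -> a != b ->
      gram G a b = S a b.
Proof.
move=> u; have [|G fG] := fitS (A := [set x in [:: i; j; k; l]]).
  by rewrite cardsE (card_uniqP u).
by exists G; split=> // a b aA bA; apply: fG.1; rewrite inE.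
Qed.

(** The three ways to split four indices into two pairs give the same product, so two disjoint edges
    span a clique. *)
Lemma tetrad_clique i j k l : uniq [:: i; j; k; l] -> S i j * S k l != 0 ->
  [/\ S i k * S j l = S i j * S k l, S i l * S j k = S i j * S k l,
      [/\ S i j != 0, S i k != 0 & S i l != 0] &
      [/\ S j k != 0, S j l != 0 & S k l != 0]].
Proof.
move=> u nz; have t2 : S i l * S j k = S i k * S j l by rewrite (tetrad u).
have t1 : S i k * S j l = S i j * S k l.
  rewrite (symS j l) (tetrad (j := l)) ?(symS l k) //; move: u.
  rewrite /= !inE !negb_or => /and4P[/and3P[ij ik il] /andP[jk jl] kl _].
  by solve_uniq.
have := nz; rewrite mulf_eq0 => /norP[nij nkl].
have := nz; rewrite -t1 mulf_eq0 => /norP[nik njl].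
have := nz; rewrite -t1 -t2 mulf_eq0 => /norP[nil njk].
by rewrite t2 t1.
Qed.

(** If the triangle i, j, k had a negative product, then [y < 0 <= gram G i i], and [gram2_cube_ge0]
    would make the product over j, k, l nonnegative. But by the tetrads the two triangle products
    multiply to a nonzero square. *)
Lemma tetrad_quadruple_gt0 i j k l : uniq [:: i; j; k; l] ->
  S i j * S k l != 0 -> 0 < S i j * S i k * S j k.
Proof.
move=> u nz; have := u; rewrite /= !inE !negb_or.
move=> /and4P[/and3P[ij ik il] /andP[jk jl] kl _].
have [t1 t2 [nij nik nil] [njk njl nkl]] := tetrad_clique u nz.
have qn : S i j * S i k * S j k != 0 by rewrite !mulf_neq0.
rewrite ltNge; apply/negP => q0.
have {}q0 : S i j * S i k * S j k < 0 by rewrite lt_neqAle qn.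
have [G [_ gE]] := fits_quadruple u.
have i4 : i \in [:: i; j; k; l] by rewrite !inE eqxx.
have j4 : j \in [:: i; j; k; l] by rewrite !inE eqxx orbT.
have k4 : k \in [:: i; j; k; l] by rewrite !inE eqxx !orbT.
have l4 : l \in [:: i; j; k; l] by rewrite !inE eqxx !orbT.
pose y := S i j * S i k / S j k.
have y0 : y < 0.
  have -> : y = (S i j * S i k * S j k) / (S j k) ^+ 2 by rewrite /y; field.
  by rewrite pmulr_llt0 // invr_gt0 exprn_even_gt0.
have := @gram2_cube_ge0 _ _ G i j k l y.
rewrite (gE i j) // (gE i k) // (gE i l) // (gE j k) // (gE j l) // (gE k l) //.
have -> : S i j * S i k = y * S j k by rewrite /y; field.
have -> : S i j * S i l = y * S j l.
  by apply: (mulIf njk); rewrite -mulrA t2 -t1 /y; field.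
have -> : S i k * S i l = y * S k l.
  by apply: (mulIf njk); rewrite -mulrA t2 /y; field.
have x0 := gram_ge0 G i.
have c0 : 0 < (gram G i i - y) ^+ 3.
  by rewrite exprn_gt0 // subr_gt0 (lt_le_trans y0).
move=> /(_ erefl erefl erefl); rewrite pmulr_lge0 //.
have e : (S i j * S i k * S j k) * (S j k * S j l * S k l) =
    (S j k * (S i k * S j l)) ^+ 2.
  transitivity (S j k ^+ 2 * (S i j * S k l) * (S i k * S j l)); first by ring.
  by rewrite -t1; ring.
have : 0 < (S j k * (S i k * S j l)) ^+ 2 by rewrite exprn_even_gt0 // !mulf_neq0.
by rewrite -e nmulr_rgt0 // ltNge => /negP.
Qed.

(** Taking [y = g i ^+ 2] in [gram2_cube_ge0], the triangle factor is a positive square, so g_i^2 <=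
    |v_i|^2, which is below the diagonal entry. *)
Lemma rank1_diag_lt (g : 'I_p -> R) i j k l : uniq [:: i; j; k; l] ->
  (forall a b, a != b -> S a b = g a * g b) ->
  g j != 0 -> g k != 0 -> g l != 0 -> g i ^+ 2 < S i i.
Proof.
move=> u Sg gj gk gl; have := u; rewrite /= !inE !negb_or.
move=> /and4P[/and3P[ij ik il] /andP[jk jl] kl _].
have [G [fG gE]] := fits_quadruple u.
have i4 : i \in [:: i; j; k; l] by rewrite !inE eqxx.
have j4 : j \in [:: i; j; k; l] by rewrite !inE eqxx orbT.
have k4 : k \in [:: i; j; k; l] by rewrite !inE eqxx !orbT.
have l4 : l \in [:: i; j; k; l] by rewrite !inE eqxx !orbT.
have xS : gram G i i < S i i by apply: fG.2; rewrite inE.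
apply: le_lt_trans xS.
have := @gram2_cube_ge0 _ _ G i j k l (g i ^+ 2).
rewrite (gE i j) // (gE i k) // (gE i l) // (gE j k) // (gE j l) // (gE k l) //.
rewrite !Sg //; do 3![move=> /(_ ltac:(ring))].
have -> : g j * g k * (g j * g l) * (g k * g l) = (g j * g k * g l) ^+ 2 by ring.
rewrite pmulr_rge0 ?exprn_even_gt0 ?mulf_neq0 //.
by rewrite real_exprn_odd_ge0 ?num_real // subr_ge0.
Qed.

Lemma fits_of_disjoint_edges i j k l : uniq [:: i; j; k; l] ->
  S i j * S k l != 0 -> exists G : 'M[R]_(p, 2), fits S setT G.
Proof.
move=> u nz; have := u; rewrite /= !inE !negb_or.
move=> /and4P[/and3P[ij ik il] /andP[jk jl] kl _].
have [t1 t2 [nij nik nil] [njk njl nkl]] := tetrad_clique u nz.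
have q0 := tetrad_quadruple_gt0 u nz.
(* A rank-one form g_a g_b forces g_i^2 to be this [y], and then g_a = S_ia / g_i for the other
   indices. *)
pose y := S i j * S i k / S j k.
have y0 : 0 < y.
  have -> : y = (S i j * S i k * S j k) / (S j k) ^+ 2 by rewrite /y; field.
  by rewrite divr_gt0 // exprn_even_gt0.
pose r := Num.sqrt y.
have r0 : r != 0 by rewrite gt_eqF // sqrtr_gt0.
have r2 : r ^+ 2 = y by rewrite sqr_sqrtr // ltW.
pose g a := if a == i then r else S i a / r.
(* This is the rank-one identity with denominators cleared. Tetrads through [i] exchange [j], [k]
   for [a], [b] one at a time; the cases treat coincidences, where a tetrad would repeat an
   index. *)
have claim a b : a != i -> b != i -> a != b ->
    S i a * S i b * S j k = S a b * (S i j * S i k).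
  move=> ai bi ab.
  have half x z w : uniq [:: i; x; z; w] -> S i x * S z w = S i z * S x w.
    rewrite (symS z w) (symS x w) /= !inE !negb_or.
    move=> /and4P[/and3P[ix iz iw] /andP[xz xw] zw _].
    by apply: tetrad; solve_uniq.
  have [aj|aj] := eqVneq a j; last have [ak|ak] := eqVneq a k.
  - have [bk|bk] := eqVneq b k; first by rewrite aj bk; ring.
    rewrite {}aj in ai ab *.
    rewrite -mulrA (symS j k) (half b k j); last by solve_uniq.
    by rewrite (symS b j); ring.
  - have [bj|bj] := eqVneq b j; first by rewrite ak bj (symS k j); ring.
    rewrite {}ak in ai ab *; rewrite -mulrA (half b j k); last by solve_uniq.
    by rewrite (symS b k); ring.
  - have [bj|bj] := eqVneq b j.
      rewrite bj mulrAC (symS j k) (half a k j); last by solve_uniq.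
      by ring.
    rewrite mulrAC (half a j k); last by solve_uniq.
    have [bk|bk] := eqVneq b k; first by rewrite bk; ring.
    have := half b k a; rewrite (symS k a) (symS b a) => h.
    transitivity (S i j * (S i b * S a k)); first by ring.
    by rewrite h; [ring|solve_uniq].
have gE a b : a != b -> S a b = g a * g b.
  rewrite /g; have [->|ai] := eqVneq a i; have [->|bi] := eqVneq b i.
  - by [].
  - by move=> _; field.
  - by move=> _; rewrite symS; field.
  move=> ab; have := claim a b ai bi ab.
  have -> : S i a / r * (S i b / r) = S i a * S i b / y.
    by rewrite -r2; field.
  by rewrite /y => h; field: h; rewrite ?nij ?nik ?njk.
have gi : g i != 0 by rewrite /g eqxx.
have gnz a : i != a -> S i a != 0 -> g a != 0.
  by move=> ia nz'; rewrite /g [a == i]eq_sym (negbTE ia) mulf_neq0 // invr_eq0.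
have gj := gnz j ij nij; have gk := gnz k ik nik; have gl := gnz l il nil.
exists (\matrix_(a, c) if c == 0 then g a else 0).
have GE a b : gram (\matrix_(a < p, c < 2) if c == 0 then g a else 0) a b =
    g a * g b.
  by rewrite gram2E !mxE /= mulr0 addr0.
split=> [a b _ _ ab|a _]; rewrite GE; first by rewrite -gE.
rewrite -expr2.
have lt := rank1_diag_lt _ gE.
(* Each index needs three others where [g] is nonzero: [i], [j], [k] use the rest of the quadruple,
   and any other index, [l] included, uses [i], [j], [k]. *)
have [->|ai] := eqVneq a i; first exact: (lt i j k l).
have [->|aj] := eqVneq a j; first by apply: (lt j i k l) => //; solve_uniq.
have [->|ak] := eqVneq a k; first by apply: (lt k i j l) => //; solve_uniq.
by apply: (lt a i j k) => //; solve_uniq.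
Qed.

Lemma fits_of_no_disjoint_edges :
  (forall i j k l, uniq [:: i; j; k; l] -> S i j * S k l = 0) ->
  exists G : 'M[R]_(p, 2), fits S setT G.
Proof.
move=> disj.
have ext (B : {set 'I_p}) : (#|B| <= 6)%N ->
    (forall a b, a \notin B -> a != b -> S a b = 0) ->
    exists G : 'M[R]_(p, 2), fits S setT G.
  move=> /fitS[G fG] S0; exists (\matrix_(a, k) if a \in B then G a k else 0).
  by apply: fits_extend0 => //; apply/matrixP => a b; rewrite mxE symS.
have edgeP i j k l : S i j != 0 -> uniq [:: i; j; k; l] -> S k l = 0.
  by move=> nij /disj/eqP; rewrite mulf_eq0 (negbTE nij) => /eqP.
(* Two edges meeting at [i]: an edge leaving the set [i], [j], [k] must end at [i], otherwise it
   misses one of the two edges. *)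
have [[[i j] k] /= /and5P[ij ik jk nij nik]|path2] :=
  pickP [pred x : 'I_p * 'I_p * 'I_p | [&& x.1.1 != x.1.2, x.1.1 != x.2,
    x.1.2 != x.2, S x.1.1 x.1.2 != 0 & S x.1.1 x.2 != 0]].
  apply: (ext [set x in [:: i; j; k]]).
    by rewrite cardsE (leq_trans (card_size _)).
  move=> a b; rewrite !inE !negb_or => /and3P[ai aj ak] ab.
  apply/eqP/negPn/negP => nab.
  have [bi|bi] := eqVneq b i; last first.
    have [bj|bj] := eqVneq b j.
      rewrite bj in nab ab; move/eqP: nab; apply.
      by apply: (edgeP i k) => //; solve_uniq.
    by move/eqP: nab; apply; apply: (edgeP i j) => //; solve_uniq.
  rewrite {b}bi in ab nab; have nia : S i a != 0 by rewrite symS.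
  have Sjk : S j k = 0 by apply: (edgeP i a) => //; solve_uniq.
  have Saj : S a j = 0 by apply: (edgeP i k) => //; solve_uniq.
  have Sak : S a k = 0 by apply: (edgeP i j) => //; solve_uniq.
  have [|G [_ gE]] := @fits_quadruple i a j k; first by solve_uniq.
  have i4 : i \in [:: i; a; j; k] by rewrite !inE eqxx.
  have a4 : a \in [:: i; a; j; k] by rewrite !inE eqxx orbT.
  have j4 : j \in [:: i; a; j; k] by rewrite !inE eqxx !orbT.
  have k4 : k \in [:: i; a; j; k] by rewrite !inE eqxx !orbT.
  (* The leaves [a], [j], [k] are pairwise orthogonal, so the determinant is the product of their
     squared lengths, each nonzero because of the edge to [i]. *)
  have := gram2_det3 G a j k; rewrite (gE a j) // (gE a k) // (gE j k) //.
  rewrite Saj Sak Sjk !expr0n /= !mulr0 !subr0 addr0 => /eqP.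
  have gn x : x \in [:: i; a; j; k] -> i != x -> S i x != 0 -> gram G x x != 0.
    by move=> x4 ix; apply: contraNneq => /gram_diag_eq0/(_ i); rewrite gE // => ->.
  by rewrite !mulf_eq0 !(negbTE (gn _ _ _ _)) // eq_sym.
(* No two edges share a vertex now, and none are disjoint, so there is at most one edge. *)
have [[i j] /= /andP[ij nij]|edge0] :=
  pickP [pred x : 'I_p * 'I_p | (x.1 != x.2) && (S x.1 x.2 != 0)].
  apply: (ext [set x in [:: i; j]]).
    by rewrite cardsE (leq_trans (card_size _)).
  move=> a b; rewrite !inE !negb_or => /andP[ai aj] ab.
  apply/eqP/negPn/negP => nab.
  have [bi|bi] := eqVneq b i.
    have := path2 (i, j, a); rewrite /= ij nij -[S i a]symS -bi nab !andbT.
    by rewrite bi eq_sym ai eq_sym aj.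
  have [bj|bj] := eqVneq b j.
    have := path2 (j, i, a); rewrite /= -[S j i]symS nij -[S j a]symS -bj nab !andbT.
    by rewrite bj ![j == _]eq_sym aj ij eq_sym ai.
  by move/eqP: nab; apply; apply: (edgeP i j) => //; solve_uniq.
apply: (ext set0) => [|a b _ ab]; first by rewrite cards0.
by have /= := edge0 (a, b); rewrite ab => /negbFE/eqP.
Qed.

End Tetrads.

(** * The cases m = 0, 1, 2 *)

(** Allowing fewer than [n] indices spares the other arguments any concern about coinciding
    indices. *)
Lemma fits_small_sets (R : rcfType) (m p : nat) (S : 'M[R]_p) n :
  (n <= p)%N ->
  (forall A : {set 'I_p}, #|A| = n -> factor_model m (principal_submx S A)) ->
  forall B : {set 'I_p}, (#|B| <= n)%N -> exists G : 'M[R]_(p, m), fits S B G.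
Proof.
move=> np fmS B Bn.
have [|A BA /fmS/factor_model_principal[G fG]] := @exists_superset_card _ B n.
  by rewrite Bn card_ord.
by exists G; exact: fits_sub fG.
Qed.

Lemma det_mx2 (R : comNzRingType) (M : 'M[R]_2) :
  \det M = M 0 0 * M 1 1 - M 0 1 * M 1 0.
Proof.
rewrite (expand_det_row _ 0) !big_ord_recl big_ord0 /cofactor !det_mx11 !mxE /=.
rewrite !expr0 !mul1r addr0 expr1 mulN1r mulrN.
by congr (_ * M _ _ - M _ _ * M _ _); apply/val_inj.
Qed.

Lemma fits_one_factor (R : rcfType) (p : nat) (S : 'M[R]_p) : S^T = S ->
  (forall A : {set 'I_p}, (#|A| <= 4)%N -> exists G : 'M[R]_(p, 1), fits S A G) ->
  exists G : 'M[R]_(p, 1), fits S setT G.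
Proof.
move=> symS fitS.
have [[i j] /= /andP[ij nij]|edge0] :=
  pickP [pred x : 'I_p * 'I_p | (x.1 != x.2) && (S x.1 x.2 != 0)].
  apply: (@fits_of_unit_minor _ _ _ _ (fun _ => i) (fun _ => j)) => //.
    by move=> k l _; rewrite !ord1.
  by rewrite unitmxE det_mx11 mxE unitfE.
have posS a : 0 < S a a.
  by have [|G /fits_diag_gt0->] := fitS [set a]; rewrite ?cards1 ?set11.
have [|G fG] := fitS set0; first by rewrite cards0.
exists (\matrix_(a, k) if a \in set0 then G a k else 0).
apply: fits_extend0 => // a b _ ab.
by have /= := edge0 (a, b); rewrite ab => /negbFE/eqP.
Qed.

Lemma fits_two_factors (R : rcfType) (p : nat) (S : 'M[R]_p) : S^T = S ->
  (forall A : {set 'I_p}, (#|A| <= 6)%N -> exists G : 'M[R]_(p, 2), fits S A G) ->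
  exists G : 'M[R]_(p, 2), fits S setT G.
Proof.
move=> symS fitS.
have symE a b : S a b = S b a by rewrite -{1}symS mxE.
have posS a : 0 < S a a.
  by have [|G /fits_diag_gt0->] := fitS [set a]; rewrite ?cards1 ?set11.
(* A tetrad is the minor with rows at entries 0, 1 and columns at entries 2, 3 of the tuple; tuples
   form a finite type, so a nonzero one can be searched for. *)
have [x /andP[u nz]|tet0] := pickP [pred x : 4.-tuple 'I_p | uniq x &&
  (S (tnth x 0) (tnth x 2) * S (tnth x 1) (tnth x 3) !=
   S (tnth x 0) (tnth x 3) * S (tnth x 1) (tnth x 2))].
  pose f (k : 'I_2) := if k == 0 then tnth x 0 else tnth x 1.
  pose g (k : 'I_2) := if k == 0 then tnth x 2 else tnth x 3.
  have inj := tuple_uniqP x u.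
  apply: (@fits_of_unit_minor _ _ _ _ f g) => //.
  - move=> k l; rewrite /f; case: k => [[|[|//]] ?];
    case: l => [[|[|//]] ?] //= /inj // _;
    exact: val_inj.
  - by move=> k l; rewrite /f /g; do 2!case: ifP => _; rewrite (inj_eq inj).
  - by rewrite unitmxE unitfE det_mx2 !mxE /= subr_eq0.
have tetrad i j k l : uniq [:: i; j; k; l] -> S i k * S j l = S i l * S j k.
  suff h (x : 4.-tuple 'I_p) : uniq x ->
      S (tnth x 0) (tnth x 2) * S (tnth x 1) (tnth x 3) =
      S (tnth x 0) (tnth x 3) * S (tnth x 1) (tnth x 2).
    exact: (h [tuple i; j; k; l]).
  by move=> u; have /= := tet0 x; rewrite u => /negbFE/eqP.
have [x /andP[u nz]|disj0] := pickP [pred x : 4.-tuple 'I_p | uniq x &&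
  (S (tnth x 0) (tnth x 1) * S (tnth x 2) (tnth x 3) != 0)].
  apply: (fits_of_disjoint_edges symE fitS tetrad _ nz).
  by case: x u {nz} => [[|a [|b [|c [|d []]]]]].
apply: fits_of_no_disjoint_edges => // i j k l.
suff h (x : 4.-tuple 'I_p) : uniq x ->
    S (tnth x 0) (tnth x 1) * S (tnth x 2) (tnth x 3) = 0.
  exact: (h [tuple i; j; k; l]).
by move=> u; have /= := disj0 x; rewrite u => /negbFE/eqP.
Qed.

Theorem theorem1 (R : rcfType) (m p : nat) (S : 'M[R]_p) :
  (m <= 2)%N -> (2 * m.+1 <= p)%N -> posdef S ->
  (factor_model m S <->
   (forall A : {set 'I_p}, #|A| = (2 * m.+1)%N ->
      factor_model m (principal_submx S A))).
Proof.
move=> m2 mp [symS _]; split=> [/factor_modelE[G fG] A _|].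
  by apply/factor_model_principal; exists G; apply: fits_sub fG; exact: subsetT.
move=> /(fits_small_sets mp) fitS; apply/factor_modelE.
case: m m2 mp fitS => [|[|[|//]]] _ _ fitS.
(* For m = 0 the empty minor has determinant 1, so the minor argument covers the diagonal case. *)
- have e : 'I_0 -> 'I_p by case.
  apply: (@fits_of_unit_minor _ _ _ _ e e) => //; try by case.
  by rewrite unitmxE det_mx00 unitr1.
- exact: fits_one_factor.
- exact: fits_two_factors.
Qed.
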